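(* Let $\mathfrak{g}$ be a Lie algebra, $(M,\bullet)$ a $\mathfrak{g}$-module, and $(T, N, S)$ an $\mathcal{ON}$-structure on $M$ over $\mathfrak{g}$ in which $T$ is invertible. Then $\Omega := T^{-1} \circ N = S \circ T^{-1} : \mathfrak{g} \to M$ is a solution of the strong Maurer-Cartan equation on the twilled Lie algebra $\mathfrak{g} \bowtie M^T$.
   Context: All vector spaces are over a field of characteristic $0$. An $\mathcal{O}$-operator on a $\mathfrak{g}$-module $(M,\bullet)$ over the Lie algebra $\mathfrak{g}$ is a linear map $T: M\to\mathfrak{g}$ with $[T(m),T(n)] = T(T(m)\bullet n - T(n)\bullet m)$ for all $m,n\in M$. For any linear map $T:M\to\mathfrak{g}$ put $[m,n]^T := T(m)\bullet n - T(n)\bullet m$; if $T$ is an $\mathcal{O}$-operator this is a Lie bracket on $M$, and $M^T$ denotes the Lie algebra $(M,[~,~]^T)$. A Nijenhuis operator on $\mathfrak{g}$ is a linear map $N:\mathfrak{g}\to\mathfrak{g}$ with $[Nx,Ny] = N([Nx,y]+[x,Ny]-N[x,y])$. A Nijenhuis structure on $M$ over $\mathfrak{g}$ is a pair $(N,S)$ with $N\in\mathrm{End}(\mathfrak{g})$ a Nijenhuis operator and $S\in\mathrm{End}(M)$ satisfying $N(x)\bullet S(m) = S(N(x)\bullet m) + x\bullet S^2(m) - S(x\bullet S(m))$ for all $x\in\mathfrak{g}, m\in M$. An $\mathcal{ON}$-structure on $M$ over $\mathfrak{g}$ is a triple $(T,N,S)$ where $T$ is an $\mathcal{O}$-operator,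 $(N,S)$ is a Nijenhuis structure, $N\circ T = T\circ S$, and $[m,n]^{N\circ T} = [m,n]^T_S$ for all $m,n\in M$, where $[m,n]^T_S := [S(m),n]^T + [m,S(n)]^T - S([m,n]^T)$. A twilled Lie algebra $\mathfrak{a}\bowtie\mathfrak{b}$ is a Lie algebra which is the direct sum, as a vector space, of two Lie subalgebras $\mathfrak{a},\mathfrak{b}$. Decomposing $[x,u] = x\bullet_1 u - u\bullet_2 x$ for $x\in\mathfrak{a},u\in\mathfrak{b}$ (with $x\bullet_1 u\in\mathfrak{b}$, $u\bullet_2 x\in\mathfrak{a}$) gives representations $\bullet_1$ of $\mathfrak{a}$ on $\mathfrak{b}$ and $\bullet_2$ of $\mathfrak{b}$ on $\mathfrak{a}$. A linear map $\Omega:\mathfrak{a}\to\mathfrak{b}$ is a solution of the strong Maurer-Cartan equation on $\mathfrak{a}\bowtie\mathfrak{b}$ if $d_{\mathrm{CE}}\Omega = 0$ and $\frac12[\Omega,\Omega]_{\mu_2}=0$, where for $x,y\in\mathfrak{a}$: $(d_{\mathrm{CE}}\Omega)(x,y) = x\bullet_1\Omega(y) - y\bullet_1\Omega(x) - \Omega([x,y])$ and $\frac12[\Omega,\Omega]_{\mu_2}(x,y) = [\Omega(x),\Omega(y)] - \Omega(\Omega(x)\bullet_2 y) + \Omega(\Omega(y)\bullet_2 x)$. For an $\mathcal{O}$-operator $T$, $\mathfrak{g}\bowtie M^T$ is the twilled Lie algebra on $\mathfrak{g}\oplus M$ with bracket $[[(x,m),(y,n)]]^T = ([x,y] + m\,\overline{\bullet}\,y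 - n\,\overline{\bullet}\,x,\ x\bullet n - y\bullet m + [m,n]^T)$, where $m\,\overline{\bullet}\,x = [T(m),x] + T(x\bullet m)$ (here $\mathfrak a=\mathfrak g$, $\mathfrak b=M^T$, $\bullet_1=\bullet$, $\bullet_2=\overline{\bullet}$). *)

(* Defs.v *)
From HB Require Import structures.
From mathcomp Require Import all_boot all_algebra.

Set Implicit Arguments.
Unset Strict Implicit.
Unset Printing Implicit Defensive.

Import GRing.Theory.
Local Open Scope ring_scope.

Record lieAlgebra (K : fieldType) (V : lmodType K) := LieAlgebra {
  lie_bracket :> V -> V -> V;
  lie_bilinear : bilinear_for *:%R *:%R lie_bracket;
  lie_alt : forall x, lie_bracket x x = 0;
  lie_jacobi : forall x y z,
    lie_bracket x (lie_bracket y z) + lie_bracket y (lie_bracket z x)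
      + lie_bracket z (lie_bracket x y) = 0
}.

Record lieModule (K : fieldType) (V : lmodType K) (L : lieAlgebra V)
    (M : lmodType K) := LieModule {
  lie_act :> V -> M -> M;
  lie_act_bilinear : bilinear_for *:%R *:%R lie_act;
  lie_act_bracket : forall x y m,
    lie_act (L x y) m = lie_act x (lie_act y m) - lie_act y (lie_act x m)
}.

Definition O_bracket (K : fieldType) (g : lmodType K) (L : lieAlgebra g)
    (M : lmodType K) (act : lieModule L M) (T : {linear M -> g}) (m n : M) : M :=
  act (T m) n - act (T n) m.

Definition O_operator (K : fieldType) (g : lmodType K) (L : lieAlgebra g)
    (M : lmodType K) (act : lieModule L M) (T : {linear M -> g}) : Prop :=
  forall m n, L (T m) (T n) = T (O_bracket act T m n).

Definition Nijenhuis_operator (K : fieldType) (g : lmodType K)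
    (L : lieAlgebra g) (N : {linear g -> g}) : Prop :=
  forall x y, L (N x) (N y) = N (L (N x) y + L x (N y) - N (L x y)).

Record Nijenhuis_structure (K : fieldType) (g : lmodType K)
    (L : lieAlgebra g) (M : lmodType K) (act : lieModule L M)
    (N : {linear g -> g}) (S : {linear M -> M}) : Prop := NijenhuisStructure {
  Nijenhuis_structure_operator : Nijenhuis_operator L N;
  Nijenhuis_structure_act : forall x m,
    act (N x) (S m) = S (act (N x) m) + act x (S (S m)) - S (act x (S m))
}.

Definition deformed_bracket (K : fieldType) (M : lmodType K)
    (S : {linear M -> M}) (br : M -> M -> M) (m n : M) : M :=
  br (S m) n + br m (S n) - S (br m n).

Record ON_structure (K : fieldType) (g : lmodType K) (L : lieAlgebra g)
    (M : lmodType K) (act : lieModule L M) (T : {linear M -> g})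
    (N : {linear g -> g}) (S : {linear M -> M}) : Prop := ONStructure {
  ON_O_operator : O_operator act T;
  ON_Nijenhuis : Nijenhuis_structure act N S;
  ON_comp : N \o T =1 T \o S;
  ON_bracket : forall m n,
    O_bracket act (N \o T) m n = deformed_bracket S (O_bracket act T) m n
}.

(* The direct sum of a and b is the external one, a * b, in which a is
   identified with a x 0 and b with 0 x b. *)
Record twilledLieAlgebra (K : fieldType) (a b : lmodType K) :=
    TwilledLieAlgebra {
  twilled_lie :> lieAlgebra (a * b)%type;
  twilled_left_closed : forall x y : a, (twilled_lie (x, 0) (y, 0)).2 = 0;
  twilled_right_closed : forall u v : b, (twilled_lie (0, u) (0, v)).1 = 0
}.

Section TwilledOperations.
Context (K : fieldType) (a b : lmodType K) (W : twilledLieAlgebra a b).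

Definition twilled_bracket_left (x y : a) : a := (W (x, 0) (y, 0)).1.
Definition twilled_bracket_right (u v : b) : b := (W (0, u) (0, v)).2.

(* [x, u] = x .1 u - u .2 x, hence the sign in the second action. *)
Definition twilled_act1 (x : a) (u : b) : b := (W (x, 0) (0, u)).2.
Definition twilled_act2 (u : b) (x : a) : a := - (W (x, 0) (0, u)).1.

Definition d_CE (Omega : {linear a -> b}) (x y : a) : b :=
  twilled_act1 x (Omega y) - twilled_act1 y (Omega x)
    - Omega (twilled_bracket_left x y).

(* One half of [Omega, Omega]_{mu_2}. *)
Definition half_square_mu2 (Omega : {linear a -> b}) (x y : a) : b :=
  twilled_bracket_right (Omega x) (Omega y)
    - Omega (twilled_act2 (Omega x) y) + Omega (twilled_act2 (Omega y) x).

Definition strong_Maurer_Cartan (Omega : {linear a -> b}) : Prop :=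
  (forall x y, d_CE Omega x y = 0) /\
  (forall x y, half_square_mu2 Omega x y = 0).

End TwilledOperations.

Section BilinearTheory.
Context (K : fieldType) (U V W : lmodType K) (f : U -> V -> W).
Context (fB : bilinear_for *:%R *:%R f).

Lemma bilDl x x' y : f (x + x') y = f x y + f x' y.
Proof. by have := fB.1 y 1 x x'; rewrite /= !scale1r. Qed.

Lemma bilDr x y y' : f x (y + y') = f x y + f x y'.
Proof. by have := fB.2 x 1 y y'; rewrite /= !scale1r. Qed.

Lemma bil0l y : f 0 y = 0.
Proof. by apply: (addrI (f 0 y)); rewrite -bilDl !addr0. Qed.

Lemma bil0r x : f x 0 = 0.
Proof. by apply: (addrI (f x 0)); rewrite -bilDr !addr0. Qed.

Lemma bilNl x y : f (- x) y = - f x y.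
Proof. by apply: (addrI (f x y)); rewrite -bilDl !subrr bil0l. Qed.

Lemma bilNr x y : f x (- y) = - f x y.
Proof. by apply: (addrI (f x y)); rewrite -bilDr !subrr bil0r. Qed.

Lemma bilZl k x y : f (k *: x) y = k *: f x y.
Proof. by have := fB.1 y k x 0; rewrite /= !addr0 bil0l addr0. Qed.

Lemma bilZr k x y : f x (k *: y) = k *: f x y.
Proof. by have := fB.2 x k y 0; rewrite /= !addr0 bil0r addr0. Qed.

End BilinearTheory.

Lemma lie_anti (K : fieldType) (V : lmodType K) (L : lieAlgebra V) x y :
  L x y = - L y x.
Proof.
apply/eqP; rewrite -addr_eq0; apply/eqP.
have := lie_alt L (x + y).
by rewrite (bilDl (lie_bilinear L)) !(bilDr (lie_bilinear L)) !lie_alt add0r addr0.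
Qed.

(* The semidirect product of g by M, M being an abelian ideal.  The Lie algebra
   axioms of M^T and of the twilled Lie algebra of an O-operator T are pulled
   back from it along m |-> (T m, m) and (x, m) |-> (x + T m, m). *)
Section SemidirectProduct.
Context (K : fieldType) (g : lmodType K) (L : lieAlgebra g) (M : lmodType K).
Context (act : lieModule L M).

Definition semidirect_bracket (p q : g * M) : g * M :=
  (L p.1 q.1, act p.1 q.2 - act q.1 p.2).

Lemma semidirect_bilinear : bilinear_for *:%R *:%R semidirect_bracket.
Proof.
have LB := lie_bilinear L; have AB := lie_act_bilinear act.
split=> [q k p p'|p k q q']; congr pair => /=.
- by rewrite (bilDl LB) (bilZl LB).
- rewrite (bilDl AB) (bilZl AB) (bilDr AB) (bilZr AB) scalerBr.
  by rewrite opprD addrACA.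
- by rewrite (bilDr LB) (bilZr LB).
- rewrite (bilDr AB) (bilZr AB) (bilDl AB) (bilZl AB) scalerBr.
  by rewrite opprD addrACA.
Qed.

Lemma semidirect_alt p : semidirect_bracket p p = 0.
Proof. by rewrite /semidirect_bracket lie_alt subrr. Qed.

Lemma semidirect_jacobi p q r :
  semidirect_bracket p (semidirect_bracket q r)
    + semidirect_bracket q (semidirect_bracket r p)
    + semidirect_bracket r (semidirect_bracket p q) = 0.
Proof.
have AB := lie_act_bilinear act.
case: p q r => [x m] [y n] [z o]; congr pair => /=; first exact: lie_jacobi.
rewrite !lie_act_bracket !(bilDr AB) !(bilNr AB).
rewrite !opprB.
set a1 := act x _; set a2 := act x _; set a3 := act z _; set a4 := act y _.
set a5 := act y _; set a6 := act z _.
rewrite -!addrA !addKr (addrCA a3 (- a5)) (addrCA a3 a2) addNKr.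
by rewrite (addrCA (- a2)) !addKr subrr.
Qed.

End SemidirectProduct.

Section PullBack.
Context (K : fieldType) (V W : lmodType K) (brV : V -> V -> V) (brW : W -> W -> W).
Context (f : {linear V -> W}) (f_inj : injective f).
Context (f_hom : forall x y, f (brV x y) = brW (f x) (f y)).

Lemma pullback_bilinear :
  bilinear_for *:%R *:%R brW -> bilinear_for *:%R *:%R brV.
Proof.
move=> B; split=> [y k x x'|x k y y'] /=; apply: f_inj.
  by rewrite f_hom !linearP !f_hom (bilDl B) (bilZl B).
by rewrite f_hom !linearP !f_hom (bilDr B) (bilZr B).
Qed.

Lemma pullback_alt : (forall x, brW x x = 0) -> forall x, brV x x = 0.
Proof. by move=> alt x; apply: f_inj; rewrite f_hom alt linear0. Qed.

Lemma pullback_jacobi :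
  (forall x y z, brW x (brW y z) + brW y (brW z x) + brW z (brW x y) = 0) ->
  forall x y z, brV x (brV y z) + brV y (brV z x) + brV z (brV x y) = 0.
Proof. by move=> J x y z; apply: f_inj; rewrite !linearD !f_hom J linear0. Qed.

End PullBack.

Section OOperatorTwilled.
Context (K : fieldType) (g : lmodType K) (L : lieAlgebra g) (M : lmodType K).
Context (act : lieModule L M) (T : {linear M -> g}).

Definition O_bar_act (m : M) (x : g) : g := L (T m) x + T (act x m).

Definition O_double_bracket (p q : g * M) : g * M :=
  (L p.1 q.1 + O_bar_act p.2 q.1 - O_bar_act q.2 p.1,
   act p.1 q.2 - act q.1 p.2 + O_bracket act T p.2 q.2).

Definition O_twist (p : g * M) : g * M := (p.1 + T p.2, p.2).

Lemma O_twist_linear : linear O_twist.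
Proof.
move=> k [x m] [y n]; congr pair => /=.
by rewrite linearP scalerDr addrACA.
Qed.
HB.instance Definition _ := GRing.isLinear.Build K _ _ _ O_twist O_twist_linear.

Lemma O_twist_inj : injective O_twist.
Proof. by move=> [x m] [y n] [/[swap] -> /addIr ->]. Qed.

Definition O_graph (m : M) : g * M := (T m, m).

Lemma O_graph_linear : linear O_graph.
Proof. by move=> k m n; rewrite /O_graph linearP. Qed.
HB.instance Definition _ := GRing.isLinear.Build K _ _ _ O_graph O_graph_linear.

Lemma O_graph_inj : injective O_graph.
Proof. by move=> m n []. Qed.

Context (TO : O_operator act T).

Lemma O_graph_hom m n :
  O_graph (O_bracket act T m n) = semidirect_bracket act (O_graph m) (O_graph n).
Proof. by congr pair; rewrite -TO. Qed.

Lemma O_twist_hom p q :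
  O_twist (O_double_bracket p q) = semidirect_bracket act (O_twist p) (O_twist q).
Proof.
have LB := lie_bilinear L; have AB := lie_act_bilinear act.
case: p q => [x m] [y n]; congr pair => /=.
  rewrite (linearD T) -TO linearB (bilDl LB) !(bilDr LB) /O_bar_act.
  rewrite (lie_anti L (T n) x) opprD opprK -!addrA addKr.
  by rewrite (addrCA (L x (T n)) (- _)) addNKr (addrCA (L (T m) y)).
rewrite !(bilDl AB) /O_bracket opprD.
by rewrite addrACA.
Qed.

(* M^T. *)
Definition O_lieAlgebra : lieAlgebra M :=
  LieAlgebra
    (pullback_bilinear O_graph_inj O_graph_hom (semidirect_bilinear act))
    (pullback_alt O_graph_inj O_graph_hom (semidirect_alt act))
    (pullback_jacobi O_graph_inj O_graph_hom (semidirect_jacobi act)).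

Definition O_double_lieAlgebra : lieAlgebra (g * M)%type :=
  LieAlgebra
    (pullback_bilinear O_twist_inj O_twist_hom (semidirect_bilinear act))
    (pullback_alt O_twist_inj O_twist_hom (semidirect_alt act))
    (pullback_jacobi O_twist_inj O_twist_hom (semidirect_jacobi act)).

Lemma O_double_left_closed (x y : g) : (O_double_lieAlgebra (x, 0) (y, 0)).2 = 0.
Proof.
have AB := lie_act_bilinear act.
by rewrite /= /O_bracket !linear0 !(bil0r AB) !subrr addr0.
Qed.

Lemma O_double_right_closed (m n : M) : (O_double_lieAlgebra (0, m) (0, n)).1 = 0.
Proof.
have LB := lie_bilinear L; have AB := lie_act_bilinear act.
by rewrite /= /O_bar_act !(bil0r LB) !(bil0l AB) !linear0 !addr0 subr0.
Qed.

(* The twilled Lie algebra of g and M^T. *)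
Definition O_twilled : twilledLieAlgebra g M :=
  TwilledLieAlgebra O_double_left_closed O_double_right_closed.

Lemma O_twilled_bracket_left x y : twilled_bracket_left O_twilled x y = L x y.
Proof.
have LB := lie_bilinear L; have AB := lie_act_bilinear act.
rewrite /twilled_bracket_left /= /O_bar_act !linear0 !(bil0r AB) !(bil0l LB).
by rewrite !linear0 !addr0 subr0.
Qed.

Lemma O_twilled_bracket_right m n :
  twilled_bracket_right O_twilled m n = O_lieAlgebra m n.
Proof.
have AB := lie_act_bilinear act.
by rewrite /twilled_bracket_right /= !(bil0l AB) subr0 add0r.
Qed.

Lemma O_twilled_act1 x m : twilled_act1 O_twilled x m = act x m.
Proof.
have AB := lie_act_bilinear act.
by rewrite /twilled_act1 /= /O_bracket !linear0 !(bil0l AB) !(bil0r AB) !subr0 addr0.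
Qed.

Lemma O_twilled_act2 m x : twilled_act2 O_twilled m x = O_bar_act m x.
Proof.
have LB := lie_bilinear L; have AB := lie_act_bilinear act.
rewrite /twilled_act2 /= {1}/O_bar_act !linear0 (bil0l LB) !(bil0r LB) (bil0r AB).
by rewrite linear0 !addr0 add0r opprK.
Qed.

End OOperatorTwilled.

(* Main.v *)
(* Put x = T m and y = T n, so that Omega x = S m.  Since N T = T S, the
   compatibility of brackets in the ON-structure reads
     T m . S n - T n . S m = S (T m . n - T n . m),                          (1)
   which is d_CE Omega = 0.  As T is an O-operator, the action of S m on T n
   is T (T (S m) . n), so the second equation amounts to the symmetry in m
   and n of T (S m) . S n - S (T (S m) . n).  The Nijenhuis structure turns
   this expression into T m . S (S n) - S (T m . S n), which (1), applied to m
   and S n, turns into T (S n) . S m - S (T (S n) . m). *)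
Require Import Defs.
From mathcomp Require Import all_boot all_algebra.

Set Implicit Arguments.
Unset Strict Implicit.
Unset Printing Implicit Defensive.

Import GRing.Theory.
Local Open Scope ring_scope.

(** The O-operator identity expands [L (T m) (T n)], whose second term cancels [T (act (T n) m)]. *)
Lemma O_bar_act_image (K : fieldType) (g : lmodType K) (L : lieAlgebra g)
    (M : lmodType K) (act : lieModule L M) (T : {linear M -> g}) :
  O_operator act T ->
  forall m n, O_bar_act act T m (T n) = T (act (T m) n).
Proof. by move=> TO m n; rewrite /O_bar_act TO -linearD subrK. Qed.

Section ONStructure.
Context (K : fieldType) (g : lmodType K) (L : lieAlgebra g) (M : lmodType K).
Context (act : lieModule L M) (T : {linear M -> g}) (N : {linear g -> g}).
Context (S : {linear M -> M}) (TNS : ON_structure act T N S).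

Lemma ON_NT m : N (T m) = T (S m).
Proof. exact: (ON_comp TNS m). Qed.

(** In the compatibility of brackets, the terms where [T (S m)] or [T (S n)] acts occur on both
    sides and cancel. *)
Lemma ON_act_bracket m n :
  act (T m) (S n) - act (T n) (S m) = S (O_bracket act T m n).
Proof.
have := ON_bracket TNS m n.
rewrite /deformed_bracket /O_bracket /= !ON_NT.
rewrite addrACA [- act (T n) (S m) + _]addrC addrACA -[RHS]addrA -[LHS]addr0.
by move=> /addrI/esym/eqP; rewrite subr_eq0 => /eqP.
Qed.

Lemma ON_act_sym m n :
  act (T (S m)) (S n) - S (act (T (S m)) n) =
  act (T (S n)) (S m) - S (act (T (S n)) m).
Proof.
have := Nijenhuis_structure_act (ON_Nijenhuis TNS) (T m) n.
rewrite ON_NT => ->; rewrite -[_ + _ - S (act (T m) _)]addrA.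
(* The Nijenhuis term [S (act (T (S m)) n)] cancels the one subtracted on the left. *)
rewrite [S _ + _]addrC addrK.
have /eqP := ON_act_bracket m (S n).
rewrite /O_bracket linearB /= subr_eq => /eqP ->.
by rewrite addrAC [_ - _ - _]addrAC subrr add0r addrC.
Qed.

End ONStructure.

Theorem theorem6p8 (K : fieldType) (charK : [pchar K] =i pred0)
    (g : lmodType K) (L : lieAlgebra g) (M : lmodType K) (act : lieModule L M)
    (T : {linear M -> g}) (N : {linear g -> g}) (S : {linear M -> M})
    (TNS : ON_structure act T N S)
    (Tinv : {linear g -> M}) (TK : cancel T Tinv) (TinvK : cancel Tinv T) :
  Tinv \o N =1 S \o Tinv /\
  strong_Maurer_Cartan (O_twilled (ON_O_operator TNS)) (Tinv \o N).
Proof.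
have TO := ON_O_operator TNS.
have OmegaT m : Tinv (N (T m)) = S m by rewrite (ON_NT TNS) TK.
split=> [x|]; first by rewrite -[x]TinvK /= OmegaT TK.
split=> x y; rewrite -[x]TinvK -[y]TinvK; move: (Tinv x) (Tinv y) => m n.
  rewrite /d_CE !O_twilled_act1 O_twilled_bracket_left /= TO !OmegaT.
  by rewrite (ON_act_bracket TNS) subrr.
rewrite /half_square_mu2 O_twilled_bracket_right !O_twilled_act2 /= !OmegaT.
rewrite !(O_bar_act_image TO) !OmegaT.
(* Bringing together the terms where [T (S m)] acts forms the left side of the symmetry. *)
rewrite [_ - _ - _]addrAC (ON_act_sym TNS).
by rewrite addrAC subrK subrr.
Qed.
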